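(* Let $G$ be a group with identity $e$ and let $R$ be a weakly $G$-graded domain. If $(R,G)$ is invertible, i.e. $R_e$ is a field, then $(R,G)$ is a weakly crossed product.
   Context: A ring $R$ with unity $1$ is $G$-graded if $R=\bigoplus_{g\in G}R_g$ for additive subgroups $R_g$ with $R_gR_h\subseteq R_{gh}$ for all $g,h\in G$. $supp(R,G)=\{g\in G:R_g\neq\{0\}\}$. $(R,G)$ is weak (weakly graded) if for every $g\in G$, $R_g=\{0\}$ implies $R_{g^{-1}}=\{0\}$. A domain is a nonzero ring without zero divisors. $(R,G)$ is invertible if $R_e$ is a field. $(R,G)$ is a weakly crossed product if $R_g$ contains a unit of $R$ for every $g\in supp(R,G)$. *)

(* Defs.v *)
From mathcomp Require Import all_boot all_algebra finmap.
From mathcomp Require Import boolp classical_sets.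

Set Implicit Arguments.
Unset Strict Implicit.
Unset Printing Implicit Defensive.

Import GRing.Theory.
Local Open Scope classical_set_scope.
Local Open Scope ring_scope.

(* Rings are unital, not assumed commutative. [pzRingType] allows the zero
   ring, so [is_domain] has to exclude it. *)
Definition is_domain (R : pzRingType) : Prop :=
  (1 : R) <> 0 /\ GRing.integral_domain_axiom R.

Definition is_unit (R : pzRingType) (u : R) : Prop :=
  exists v : R, u * v = 1 /\ v * u = 1.

(* [S] is a field for the operations restricted from [R]. The identity of [S]
   is not required to be that of [R]. *)
Definition is_field_on (R : pzRingType) (S : set R) : Prop :=
  [/\ zmod_closed (mem S),
      (forall x y, S x -> S y -> S (x * y)),
      (forall x y, S x -> S y -> x * y = y * x)
    & exists u, [/\ S u, u <> 0, (forall x, S x -> u * x = x)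
      & forall x, S x -> x <> 0 -> exists2 y, S y & x * y = u]].

Section Grading.
Variables (G : groupType) (R : pzRingType) (A : G -> set R).

(* The second clause is the internal direct sum decomposition: each element is
   uniquely a sum of a finitely supported family of homogeneous components. *)
Definition is_grading : Prop :=
  [/\ (forall g, zmod_closed (mem (A g))),
      (forall x : R, exists! f : {fsfun G -> R with 0},
         (forall g, A g (f g)) /\ x = \sum_(g <- finsupp f) f g)
    & forall g h x y, A g x -> A h y -> A (g * h)%g (x * y)].

Definition grading_supp : set G := [set g | A g <> [set 0]].

Definition weakly_graded : Prop :=
  forall g : G, A g = [set 0] -> A (g^-1)%g = [set 0].

Definition invertible_grading : Prop := is_field_on (A 1%g).

Definition weakly_crossed_product : Prop :=
  forall g, grading_supp g -> exists2 u, A g u & is_unit u.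

End Grading.

(* Main.v *)
Require Import Defs.
From mathcomp Require Import all_boot all_algebra finmap.
From mathcomp Require Import boolp classical_sets.

Import GRing.Theory.
Local Open Scope classical_set_scope.
Local Open Scope ring_scope.

(** Any nonzero homogeneous [x] of degree [g] is itself a unit. Weakness supplies a nonzero [y] of
    degree [g^-1]; as [R] is a domain, [x * y] is a nonzero element of the field [A 1], hence
    invertible, so [x] has a right inverse. In a domain one-sided inverses are two-sided. *)

Lemma domain_mulrI (R : pzRingType) (x y z : R) :
  is_domain R -> x <> 0 -> x * y = x * z -> y = z.
Proof.
move=> [_ R_int] x_neq0 /eqP; rewrite -subr_eq0 -mulrBr => /eqP /R_int.
by case/orP => [/eqP // | ]; rewrite subr_eq0 => /eqP.
Qed.

(** Cancel [x] on the left in [x * (y * x) = x = x * 1]. *)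
Lemma domain_right_inverse_unit (R : pzRingType) (x y : R) :
  is_domain R -> x * y = 1 -> is_unit x.
Proof.
move=> R_domain xy1; exists y; split=> //.
apply: (domain_mulrI _ x _ _ R_domain); last by rewrite mulrA xy1 mul1r mulr1.
by move=> x0; case: R_domain => + _; apply; rewrite -xy1 x0 mul0r.
Qed.

(** The identity [u] of [S] is a nonzero idempotent, and cancelling [u] in [u * u = u * 1] forces
    [u = 1]. Inverses taken in [S] are therefore inverses in [R]. *)
Lemma field_on_right_inverse (R : pzRingType) (S : set R) (x : R) :
  is_domain R -> is_field_on S -> S x -> x <> 0 -> exists y, x * y = 1.
Proof.
move=> R_domain [_ _ _ [u [Su u_neq0 uS invS]]] Sx /(invS _ Sx) [y _ xyu].
exists y; rewrite xyu; apply: (domain_mulrI _ u _ _ R_domain) => //.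
by rewrite mulr1 uS.
Qed.

Lemma zmod_closed_nonzero (R : pzRingType) (S : set R) :
  zmod_closed (mem S) -> S <> [set 0] -> exists2 x, S x & x <> 0.
Proof.
move=> [S0 _] S_neq; apply: contra_notP S_neq => S_only0.
apply/seteqP; split=> [x Sx | _ ->]; last exact: set_mem S0.
by apply: contrapT => x_neq0; apply: S_only0; exists x.
Qed.

Theorem proposition4p11 (G : groupType) (R : pzRingType) (A : G -> set R)
    (R_domain : is_domain R) (A_grading : is_grading A)
    (A_weak : weakly_graded A) (A_invertible : invertible_grading A) :
  weakly_crossed_product A.
Proof.
move=> g g_supp; have [A_zmod _ A_mul] := A_grading.
have [x Ax x_neq0] := zmod_closed_nonzero _ _ (A_zmod g) g_supp.
have [y Ay y_neq0] : exists2 y, A (g^-1)%g y & y <> 0.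
  (* Weakness is used at [g^-1]: if that component vanished, so would [A g], against [g_supp]. *)
  by apply: zmod_closed_nonzero => // /A_weak; rewrite invgK.
have Axy : A 1%g (x * y) by rewrite -(mulgV g); apply: A_mul.
have xy_neq0 : x * y <> 0.
  by case: R_domain => _ R_int /R_int /orP[] /eqP.
have [z xyz1] := field_on_right_inverse _ _ _ R_domain A_invertible Axy xy_neq0.
exists x => //; apply: (domain_right_inverse_unit _ x (y * z)) => //.
by rewrite mulrA.
Qed.
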